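(* Let $((A,[\ ,\ ]_A,\cdot_A),\mathfrak B,P)$ be a quadratic Rota-Baxter Poisson algebra of weight $0$ and let $I_{\mathfrak B}:A^*\to A$ be the linear isomorphism induced by $\mathfrak B$, i.e. $\langle I_{\mathfrak B}^{-1}(a),b\rangle=\mathfrak B(a,b)$ for all $a,b\in A$. Let $r\in A\otimes A$ be the 2-tensor form of $P\circ I_{\mathfrak B}$, defined by $\langle r,x^*\otimes y^*\rangle=\langle (P\circ I_{\mathfrak B})(x^* ),y^*\rangle$ for all $x^*,y^*\in A^*$. Then $(A,[\ ,\ ]_A,\cdot_A,\delta_r,\Delta_r)$ is a triangular Poisson bialgebra.
   Context: All vector spaces are finite-dimensional over a field $\mathbb K$ of characteristic $0$; algebras need not be unital. A Poisson algebra $(A,[\ ,\ ]_A,\cdot_A)$ is a Lie algebra and a commutative associative algebra on the same space with $[a,b\cdot_A c]_A=[a,b]_A\cdot_A c+b\cdot_A[a,c]_A$. Write $\mathrm{ad}(a)b=[a,b]_A$, $L(a)b=a\cdot_A b$. Quadratic Rota-Baxter Poisson algebra of weight $\lambda\in\mathbb K$: a Poisson algebra with a nondegenerate symmetric bilinear form $\mathfrak B$ that is invariant ($\mathfrak B([a,b]_A,c)=\mathfrak B(a,[b,c]_A)$, $\mathfrak B(a\cdot_A b,c)=\mathfrak B(a,b\cdot_A c)$) and a linear map $P:A\to A$ that is a Rota-Baxter operator of weight $\lambda$: $[P(a),P(b)]_A=P([P(a),b]_A+[a,P(b)]_A+\lambda[a,b]_A)$, $P(a)\cdot_A P(b)=P(P(a)\cdot_A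 b+a\cdot_A P(b)+\lambda a\cdot_A b)$, such that $\mathfrak B(a,P(b))+\mathfrak B(P(a),b)+\lambda\mathfrak B(a,b)=0$ for all $a,b\in A$. Poisson bialgebra: a Poisson algebra with linear maps $\delta,\Delta:A\to A\otimes A$ such that the dual operations $\langle[x^*,y^*]_{A^*},a\rangle=\langle\delta(a),x^*\otimes y^*\rangle$, $\langle x^*\cdot_{A^*}y^*,a\rangle=\langle\Delta(a),x^*\otimes y^*\rangle$ make $A^*$ a Poisson algebra and, for all $a,b\in A$: $\delta([a,b]_A)=(\mathrm{ad}(a)\otimes\mathrm{id}+\mathrm{id}\otimes\mathrm{ad}(a))\delta(b)-(\mathrm{ad}(b)\otimes\mathrm{id}+\mathrm{id}\otimes\mathrm{ad}(b))\delta(a)$; $\Delta(a\cdot_A b)=(L(a)\otimes\mathrm{id})\Delta(b)+(\mathrm{id}\otimes L(b))\Delta(a)$; $\delta(a\cdot_A b)=(L(a)\otimes\mathrm{id})\delta(b)+(L(b)\otimes\mathrm{id})\delta(a)+(\mathrm{id}\otimes\mathrm{ad}(a))\Delta(b)+(\mathrm{id}\otimes\mathrm{ad}(b))\Delta(a)$; $\Delta([a,b]_A)=(\mathrm{ad}(a)\otimes\mathrm{id}+\mathrm{id}\otimes\mathrm{ad}(a))\Delta(b)+(L(b)\otimes\mathrm{id}-\mathrm{id}\otimes L(b))\delta(a)$. For $r=\sum_i a_i\otimes b_i$ put $\delta_r(a)=(\mathrm{id}\otimes\mathrm{ad}(a)+\mathrm{ad}(a)\otimes\mathrm{id})(r)$,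 $\Delta_r(a)=(\mathrm{id}\otimes L(a)-L(a)\otimes\mathrm{id})(r)$. $r$ is a solution of the Poisson Yang-Baxter equation if $\mathbf C(r)=\mathbf A(r)=0$, where $\mathbf C(r)=\sum_{i,j}([a_i,a_j]_A\otimes b_i\otimes b_j+a_i\otimes a_j\otimes[b_i,b_j]_A+a_i\otimes[b_i,a_j]_A\otimes b_j)$, $\mathbf A(r)=\sum_{i,j}(a_i\cdot_A a_j\otimes b_i\otimes b_j+a_i\otimes a_j\otimes b_i\cdot_A b_j-a_i\otimes a_j\cdot_A b_i\otimes b_j)$. If $r$ is an antisymmetric ($r+\tau(r)=0$, $\tau$ the flip) solution of the Poisson Yang-Baxter equation, then $(A,[\ ,\ ]_A,\cdot_A,\delta_r,\Delta_r)$ is a Poisson bialgebra (known), called a triangular Poisson bialgebra. *)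

(* Defs.v *)
From HB Require Import structures.
From mathcomp Require Import all_boot all_algebra ring.

Set Implicit Arguments.
Unset Strict Implicit.
Unset Printing Implicit Defensive.

Import GRing.Theory.
Local Open Scope ring_scope.

Section Tensor.
Variable K : fieldType.
Implicit Types U V W : vectType K.

Definition dual V : vectType K := 'Hom(V, K^o).

(* V ⊗ W is modelled by coordinate matrices with respect to the standard      *)
(* bases of V and W; [tlift_tensor] and [tens_linear_ext] give its universal  *)
(* property.                                                                  *)
Definition tens V W : vectType K := 'M[K]_(\dim {:V}, \dim {:W}).

Definition tensor V W (v : V) (w : W) : tens V W :=
  \matrix_(i, j) (coord (vbasis {:V}) i v * coord (vbasis {:W}) j w).

Definition tlift V W U (f : V -> W -> U) (r : tens V W) : U :=
  \sum_i \sum_j r i j *: f (vbasis {:V})`_i (vbasis {:W})`_j.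

End Tensor.

Notation "v ⊗ w" := (tensor v w)
  (at level 38, right associativity) : ring_scope.

Section TensorTheory.
Variable K : fieldType.
Implicit Types U V W : vectType K.

Fact tlift_is_linear V W U (f : V -> W -> U) : linear (tlift f).
Proof.
move=> c r s; rewrite /tlift scaler_sumr -big_split /=.
apply: eq_bigr => i _; rewrite scaler_sumr -big_split /=.
by apply: eq_bigr => j _; rewrite !mxE scalerDl scalerA.
Qed.
HB.instance Definition _ V W U (f : V -> W -> U) :=
  GRing.isLinear.Build K (tens V W) U _ (tlift f) (@tlift_is_linear V W U f).

Fact tensor_is_bilinear V W : bilinear_for
  (GRing.Scale.Law.clone _ _ *:%R _) (GRing.Scale.Law.clone _ _ *:%R _)
  (@tensor K V W).
Proof.
split=> [w|v] c x y; apply/matrixP => i j; rewrite !mxE linearP /=.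
  by rewrite mulrDl mulrA.
by rewrite mulrDr mulrCA.
Qed.
HB.instance Definition _ V W :=
  bilinear_isBilinear.Build K V W (tens V W) _ _ (@tensor K V W)
    (@tensor_is_bilinear V W).

Lemma tlift_tensor V W U (f : V -> W -> U) v w :
  (forall w', linear (f^~ w')) -> (forall v', linear (f v')) ->
  tlift f (v ⊗ w) = f v w.
Proof.
move=> fl fr.
pose g := GRing.isLinear.Build K V U _ (f^~ w) (fl w).
pose gl : {linear V -> U} := HB.pack (f^~ w) g.
have -> : f v w = gl v by [].
rewrite {2}(coord_vbasis (memvf v)) linear_sum; apply: eq_bigr => i _.
rewrite linearZ /=.
set v' := (vbasis _)`_i.
pose h := GRing.isLinear.Build K W U _ (f v') (fr v').
pose hl : {linear W -> U} := HB.pack (f v') h.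
have -> : f v' w = hl w by [].
rewrite [in RHS](coord_vbasis (memvf w)) linear_sum scaler_sumr.
by apply: eq_bigr => j _; rewrite linearZ /= mxE scalerA.
Qed.

Lemma tensor_vbasis V W (i : 'I_(\dim {:V})) (j : 'I_(\dim {:W})) :
  ((vbasis {:V})`_i ⊗ (vbasis {:W})`_j : tens V W) = delta_mx i j.
Proof.
apply/matrixP => k l; rewrite !mxE.
rewrite !coord_free ?(basis_free (vbasisP _)) // -natrM mulnb.
by rewrite eq_sym (eq_sym j).
Qed.

Lemma tens_sumE V W (r : tens V W) :
  r = \sum_i \sum_j r i j *: ((vbasis {:V})`_i ⊗ (vbasis {:W})`_j).
Proof.
rewrite [LHS]matrix_sum_delta; apply: eq_bigr => i _.
by apply: eq_bigr => j _; rewrite tensor_vbasis.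
Qed.

Lemma tens_linear_ext V W U (f g : {linear tens V W -> U}) :
  (forall v w, f (v ⊗ w) = g (v ⊗ w)) -> f =1 g.
Proof.
move=> fg r; rewrite (tens_sumE r) !linear_sum; apply: eq_bigr => i _.
by rewrite !linear_sum; apply: eq_bigr => j _; rewrite !linearZ fg.
Qed.

(* f ⊗ g *)
Definition tmap V V' W W' (f : V -> V') (g : W -> W') :
  tens V W -> tens V' W' := tlift (fun v w => f v ⊗ g w).
HB.instance Definition _ V V' W W' (f : V -> V') (g : W -> W') :=
  GRing.Linear.copy (tmap f g) (tlift (fun v w => f v ⊗ g w)).

Lemma tmap_tensor V V' W W' (f : {linear V -> V'}) (g : {linear W -> W'}) v w :
  tmap f g (v ⊗ w) = f v ⊗ g w.
Proof.
apply: tlift_tensor => [w'|v'] c x y.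
  by rewrite linearP linearPl.
by rewrite linearP linearPr.
Qed.

Definition flip V W : tens V W -> tens W V := tlift (fun v w => w ⊗ v).

Lemma flip_tensor V W (v : V) (w : W) : flip (v ⊗ w) = w ⊗ v.
Proof.
apply: tlift_tensor => [w'|v'] c x y; first by rewrite linearPr.
by rewrite linearPl.
Qed.

(* < r, x ⊗ y > *)
Definition tpair V W (r : tens V W) (x : dual V) (y : dual W) : K :=
  tlift (fun v w => x v * y w : K^o) r.

Lemma tpair_tensor V W (v : V) (w : W) (x : dual V) (y : dual W) :
  tpair (v ⊗ w) x y = x v * y w.
Proof.
apply: (@tlift_tensor _ _ K^o) => [w'|v'] c a b; rewrite linearP /=.
  by rewrite mulrDl -mulrA.
by rewrite mulrDr mulrCA.
Qed.

Lemma tpair_is_linear V W (x : dual V) (y : dual W) :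
  linear (fun r : tens V W => tpair r x y : K^o).
Proof. exact: tlift_is_linear. Qed.

Fact tpair_is_linearl V W (r : tens V W) (y : dual W) c x x' :
  tpair r (c *: x + x') y = c * tpair r x y + tpair r x' y.
Proof.
rewrite /tpair /tlift mulr_sumr -big_split /=; apply: eq_bigr => i _.
rewrite mulr_sumr -big_split /=; apply: eq_bigr => j _.
by rewrite !lfunE /= !lfunE /= /GRing.scale /=; ring.
Qed.

Fact tpair_is_linearr V W (r : tens V W) (x : dual V) c y y' :
  tpair r x (c *: y + y') = c * tpair r x y + tpair r x y'.
Proof.
rewrite /tpair /tlift mulr_sumr -big_split /=; apply: eq_bigr => i _.
rewrite mulr_sumr -big_split /=; apply: eq_bigr => j _.
by rewrite !lfunE /= !lfunE /= /GRing.scale /=; ring.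
Qed.

Lemma tensor_form_exists_unique V W (T : 'Hom(dual V, W)) :
  exists! r : tens V W,
    forall (x : dual V) (y : dual W), tpair r x y = y (T x).
Proof.
pose dc U i : dual U := linfun (coord (vbasis {:U}) i : U -> K^o).
have dcE U i u : dc U i u = coord (vbasis {:U}) i u by rewrite lfunE.
have basis_coord U (i j : 'I_(\dim {:U})) :
    coord (vbasis {:U}) i (vbasis {:U})`_j = (i == j)%:R.
  by rewrite coord_free ?(basis_free (vbasisP _)) // eq_sym.
exists (\sum_(i < \dim {:V}) (vbasis {:V})`_i ⊗ T (dc V i)); split.
  move=> x y.
  rewrite /tpair linear_sum /=.
  under eq_bigr do rewrite [tlift _ _]tpair_tensor.
  have xE : x = \sum_(i < \dim {:V}) x (vbasis {:V})`_i *: dc V i.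
    apply/lfunP => v; rewrite sum_lfunE {1}(coord_vbasis (memvf v)) linear_sum.
    by apply: eq_bigr => i _; rewrite linearZ /= !lfunE /= dcE /GRing.scale /= mulrC.
  rewrite [in RHS]xE !linear_sum; apply: eq_bigr => i _.
  by rewrite !linearZ.
move=> r hr; apply/matrixP => i j.
have pE (s : tens V W) : s i j = tpair s (dc V i) (dc W j).
  rewrite /tpair /tlift (bigD1 i) //= (bigD1 j) //= !dcE !basis_coord !eqxx.
  rewrite mulr1 [_ *: _]mulr1 !big1 ?addr0 // => k.
    move=> ki; apply: big1 => l _.
    by rewrite !dcE !basis_coord eq_sym (negPf ki) mul0r scaler0.
  by move=> kj; rewrite !dcE !basis_coord (eq_sym j) (negPf kj) mulr0 scaler0.
rewrite !pE hr /tpair linear_sum /=.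
under eq_bigr do rewrite [tlift _ _]tpair_tensor dcE basis_coord.
rewrite (bigD1 i) //= eqxx mul1r big1 ?addr0 // => k ki.
by rewrite eq_sym (negPf ki) mul0r.
Qed.

End TensorTheory.

Section Poisson.
Variable K : fieldType.
Implicit Type A : vectType K.

Record poisson_algebra A (br mu : {bilinear A -> A -> A}) : Prop := {
  br_alternating : forall a, br a a = 0;
  br_jacobi : forall a b c, br a (br b c) + br b (br c a) + br c (br a b) = 0;
  mu_comm : commutative mu;
  mu_assoc : associative mu;
  poisson_leibniz : forall a b c, br a (mu b c) = mu (br a b) c + mu b (br a c)
}.

Definition rota_baxter A (lambda : K) (op : A -> A -> A) (P : A -> A) : Prop :=
  forall a b, op (P a) (P b) = P (op (P a) b + op a (P b) + lambda *: op a b).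

Definition invariant A (op : A -> A -> A) (B : A -> A -> K) : Prop :=
  forall a b c, B (op a b) c = B a (op b c).

Record quadratic_rota_baxter_poisson A (br mu : {bilinear A -> A -> A})
    (B : {symmetric A}) (P : 'End(A)) (lambda : K) : Prop := {
  qrb_poisson : poisson_algebra br mu;
  qrb_nondegenerate : nondegenerate B;
  qrb_br_invariant : invariant br B;
  qrb_mu_invariant : invariant mu B;
  qrb_br_rota_baxter : rota_baxter lambda br P;
  qrb_mu_rota_baxter : rota_baxter lambda mu P;
  qrb_compat : forall a b, B a (P b) + B (P a) b + lambda * B a b = 0
}.

(* The map A -> dual A, a |-> B(a, -), and its inverse I_B.                   *)
Definition form_flat A (B : {symmetric A}) : 'Hom(A, dual A) :=
  linfun (fun a : A => linfun (B a : A -> K^o) : dual A).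

Definition form_iso A (B : {symmetric A}) : 'Hom(dual A, A) :=
  ((form_flat B)^-1)%VF.

Lemma form_flatE A (B : {symmetric A}) a b : form_flat B a b = B a b.
Proof.
have flin : linear (fun a : A => linfun (B a : A -> K^o) : dual A).
  move=> c x y; apply/lfunP => z.
  by rewrite !lfunE /= !lfunE /= lfunE linearPl.
pose flat := fun a : A => linfun (B a : A -> K^o) : dual A.
pose f : {linear A -> dual A} :=
  HB.pack flat (GRing.isLinear.Build K A (dual A) _ flat flin).
by rewrite /form_flat (lfunE f) lfunE.
Qed.

Lemma form_iso_bij A (B : {symmetric A}) : nondegenerate B ->
  cancel (form_flat B) (form_iso B) /\ cancel (form_iso B) (form_flat B).
Proof.
move=> Bnd.
have ker0 : lker (form_flat B) == 0%VS.
  rewrite -subv0 -(eqP Bnd); apply/subvP => a; rewrite memv_ker => /eqP Ba0.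
  by apply/mem_orthovP => b _; rewrite -form_flatE Ba0 lfunE.
split; first exact: lker0_lfunK.
move=> x; apply: limg_lfunVK.
suff -> : limg (form_flat B) = fullv by rewrite memvf.
apply/eqP; rewrite eqEdim subvf /= limg_dim_eq; last first.
  by rewrite (eqP ker0) capv0.
by rewrite !dimvf -[dim (dual A)]/(dim A * 1)%N muln1.
Qed.

Fact dual_op_functional A (d : {linear A -> tens A A}) (x y : dual A) :
  linear (fun a : A => tpair (d a) x y : K^o).
Proof. by move=> c a b; rewrite linearP tpair_is_linear. Qed.

(* The operation on dual A defined by < x y, a > = < d a, x ⊗ y >.            *)
Definition dual_op A (d : {linear A -> tens A A}) (x y : dual A) : dual A :=
  linfun (fun a : A => tpair (d a) x y : K^o).

Lemma dual_opE A (d : {linear A -> tens A A}) (x y : dual A) (a : A) :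
  dual_op d x y a = tpair (d a) x y.
Proof.
pose g := fun a : A => tpair (d a) x y : K^o.
pose f : {linear A -> K^o} :=
  HB.pack g (GRing.isLinear.Build K A K^o _ g (dual_op_functional d x y)).
by rewrite /dual_op (lfunE f).
Qed.

Fact dual_op_is_bilinear A (d : {linear A -> tens A A}) : bilinear_for
  (GRing.Scale.Law.clone _ _ *:%R _) (GRing.Scale.Law.clone _ _ *:%R _)
  (dual_op d).
Proof.
split=> [y|x] c z z'; apply/lfunP => a; rewrite !lfunE /= lfunE /= !dual_opE.
  by rewrite tpair_is_linearl.
by rewrite tpair_is_linearr.
Qed.
HB.instance Definition _ A (d : {linear A -> tens A A}) :=
  bilinear_isBilinear.Build K (dual A) (dual A) (dual A) _ _ (dual_op d)
    (dual_op_is_bilinear d).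

Record poisson_bialgebra A (br mu : {bilinear A -> A -> A})
    (delta Delta : {linear A -> tens A A}) : Prop := {
  bialg_poisson : poisson_algebra br mu;
  bialg_dual_poisson : poisson_algebra (dual_op delta) (dual_op Delta);
  bialg_delta_br : forall a b,
    delta (br a b) = (tmap (br a) id (delta b) + tmap id (br a) (delta b))
                   - (tmap (br b) id (delta a) + tmap id (br b) (delta a));
  bialg_Delta_mu : forall a b,
    Delta (mu a b) = tmap (mu a) id (Delta b) + tmap id (mu b) (Delta a);
  bialg_delta_mu : forall a b,
    delta (mu a b) = tmap (mu a) id (delta b) + tmap (mu b) id (delta a)
                   + tmap id (br a) (Delta b) + tmap id (br b) (Delta a);
  bialg_Delta_br : forall a b,
    Delta (br a b) = (tmap (br a) id (Delta b) + tmap id (br a) (Delta b))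
                   + (tmap (mu b) id (delta a) - tmap id (mu b) (delta a))
}.

Section Coboundary.
Variables (A : vectType K) (br mu : {bilinear A -> A -> A}) (r : tens A A).

Definition delta_r (a : A) : tens A A := tmap id (br a) r + tmap (br a) id r.
Definition Delta_r (a : A) : tens A A := tmap id (mu a) r - tmap (mu a) id r.

Fact tmapl_linear (op : {bilinear A -> A -> A}) :
  linear (fun a => tmap (op a) id r).
Proof.
move=> c a b; rewrite /tmap /tlift scaler_sumr -big_split; apply: eq_bigr => i _.
rewrite scaler_sumr -big_split; apply: eq_bigr => j _ /=.
by rewrite !linearPl scalerDr !scalerA mulrC.
Qed.

Fact tmapr_linear (op : {bilinear A -> A -> A}) :
  linear (fun a => tmap id (op a) r).
Proof.
move=> c a b; rewrite /tmap /tlift scaler_sumr -big_split; apply: eq_bigr => i _.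
rewrite scaler_sumr -big_split; apply: eq_bigr => j _ /=.
by rewrite linearPl linearPr scalerDr !scalerA mulrC.
Qed.

Fact delta_r_is_linear : linear delta_r.
Proof.
by move=> c a b; rewrite /delta_r tmapl_linear tmapr_linear scalerDr addrACA.
Qed.
HB.instance Definition _ :=
  GRing.isLinear.Build K A (tens A A) _ delta_r delta_r_is_linear.

Fact Delta_r_is_linear : linear Delta_r.
Proof.
move=> c a b; rewrite /Delta_r tmapl_linear tmapr_linear scalerBr opprD.
by rewrite addrACA.
Qed.
HB.instance Definition _ :=
  GRing.isLinear.Build K A (tens A A) _ Delta_r Delta_r_is_linear.

(* For r = \sum_i a_i ⊗ b_i, the double [tlift] below is the sum over (i, j)  *)
(* with (a, b) = (a_i, b_i) and (a', b') = (a_j, b_j), by [C_r_sumE] and      *)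
(* [A_r_sumE].                                                                *)
Definition C_term (a b a' b' : A) : tens A (tens A A) :=
  br a a' ⊗ b ⊗ b' + a ⊗ a' ⊗ br b b' + a ⊗ br b a' ⊗ b'.
Definition A_term (a b a' b' : A) : tens A (tens A A) :=
  mu a a' ⊗ b ⊗ b' + a ⊗ a' ⊗ mu b b' - a ⊗ mu a' b ⊗ b'.

Definition C_r : tens A (tens A A) :=
  tlift (fun a b => tlift (C_term a b) r) r.
Definition A_r : tens A (tens A A) :=
  tlift (fun a b => tlift (A_term a b) r) r.

Definition poisson_yang_baxter : Prop := C_r = 0 /\ A_r = 0.

Definition triangular_poisson_bialgebra : Prop :=
  [/\ r + flip r = 0, poisson_yang_baxter
    & poisson_bialgebra br mu delta_r Delta_r].

Let addrACA3 (V : zmodType) (x x' y y' z z' : V) :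
  (x + x') + (y + y') + (z + z') = (x + y + z) + (x' + y' + z').
Proof. by rewrite (addrACA x x' y y') (addrACA (x + y)). Qed.

Lemma double_tlift_sum (s : seq (A * A))
    (f : A -> A -> A -> A -> tens A (tens A A)) :
  (forall b a' b', linear (fun a => f a b a' b')) ->
  (forall a a' b', linear (fun b => f a b a' b')) ->
  (forall a b b', linear (fun a' => f a b a' b')) ->
  (forall a b a', linear (f a b a')) ->
  r = \sum_(p <- s) p.1 ⊗ p.2 ->
  tlift (fun a b => tlift (f a b) r) r =
  \sum_(p <- s) \sum_(q <- s) f p.1 p.2 q.1 q.2.
Proof.
move=> f1 f2 f3 f4 rE; rewrite {2}rE linear_sum; apply: eq_bigr => p _.
rewrite /= tlift_tensor; first last.
- move=> a c b b'; rewrite /tlift scaler_sumr -big_split; apply: eq_bigr => i _.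
  rewrite scaler_sumr -big_split; apply: eq_bigr => j _ /=.
  by rewrite f2 scalerDr !scalerA mulrC.
- move=> b c a a'; rewrite /tlift scaler_sumr -big_split; apply: eq_bigr => i _.
  rewrite scaler_sumr -big_split; apply: eq_bigr => j _ /=.
  by rewrite f1 scalerDr !scalerA mulrC.
rewrite rE linear_sum; apply: eq_bigr => q _.
by rewrite /= tlift_tensor.
Qed.

Lemma C_r_sumE (s : seq (A * A)) : r = \sum_(p <- s) p.1 ⊗ p.2 ->
  C_r = \sum_(p <- s) \sum_(q <- s)
    (br p.1 q.1 ⊗ p.2 ⊗ q.2 + p.1 ⊗ q.1 ⊗ br p.2 q.2 + p.1 ⊗ br p.2 q.1 ⊗ q.2).
Proof.
by apply: double_tlift_sum => x y z c a b;
  rewrite /C_term !(linearPl, linearPr) /= !scalerDr addrACA3.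
Qed.

Lemma A_r_sumE (s : seq (A * A)) : r = \sum_(p <- s) p.1 ⊗ p.2 ->
  A_r = \sum_(p <- s) \sum_(q <- s)
    (mu p.1 q.1 ⊗ p.2 ⊗ q.2 + p.1 ⊗ q.1 ⊗ mu p.2 q.2 - p.1 ⊗ mu q.1 p.2 ⊗ q.2).
Proof.
by apply: double_tlift_sum => x y z c a b;
  rewrite /A_term !(linearPl, linearPr) /= scalerBr !scalerDr opprD addrACA3.
Qed.

End Coboundary.

End Poisson.

(* Main.v *)
Require Import Defs.
From HB Require Import structures.
From mathcomp Require Import all_boot all_algebra ring.

(* Through B identify A with its dual, so that a tensor t is the bilinear     *)
(* form t(u, v) = <t, B(u, -) ⊗ B(v, -)>.  Then r(u, v) = B(P u, v), which is *)
(* antisymmetric by compatibility of B and P.  By invariance the dual         *)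
(* operations of delta_r and Delta_r become u * v = P(u) v + u P(v), which    *)
(* satisfy the Poisson axioms because P is a Rota-Baxter operator, and both   *)
(* Yang-Baxter equations become the vanishing of the cyclic sum of            *)
(* B(P(u) P(v), w).  The compatibility conditions are evaluated on pairs      *)
(* (u, v): the terms with P outside cancel since P is B-antisymmetric, the    *)
(* others by the Jacobi identity, associativity or the Leibniz rule.          *)

Set Implicit Arguments.
Unset Strict Implicit.
Unset Printing Implicit Defensive.

Import GRing.Theory.
Local Open Scope ring_scope.

(** The argument is carried by two readings of [r]. As an operator, [r] contracts on its first leg
    to [P] ([lcontract_r]) and on its second to [- P] ([lcontract_flip_r]); this turns the
    Yang-Baxter equations into [rota_baxter_cyclic]. As a form, it yields [tpair_delta_r] and
    [tpair_Delta_r], which identify the dual operations with [star br] and [star mu]; their Poisson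
    axioms follow since [P] carries [star op] to [op] ([rota_baxter_star]). In the compatibility
    conditions, [form_rota_baxter] cancels the terms where [P] is applied to a product, and the
    axioms of [br] and [mu] match the remaining ones with the left-hand side. *)

Section Contraction.
Variable K : fieldType.
Implicit Types U V W : vectType K.

(** * Contractions and pairings that separate tensors *)

Lemma dual_separates W (w w' : W) :
  (forall y : dual W, y w = y w') -> w = w'.
Proof.
move=> eqy; rewrite (coord_vbasis (memvf w)) (coord_vbasis (memvf w')).
apply: eq_bigr => i _; congr (_ *: _).
by have := eqy (linfun (coord (vbasis {:W}) i : W -> K^o)); rewrite !lfunE.
Qed.

Lemma dualZ V (x : dual V) c v : x (c *: v) = c * x v.
Proof. exact: linearZ. Qed.

Definition lcontract V W (x : dual V) : tens V W -> W :=
  tlift (fun v w => x v *: w).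
HB.instance Definition _ V W (x : dual V) :=
  GRing.Linear.copy (@lcontract V W x) (tlift (fun v w => x v *: w)).

Lemma lcontract_tensor V W (x : dual V) (v : V) (w : W) :
  lcontract x (v ⊗ w) = x v *: w.
Proof.
apply: tlift_tensor => [w'|v'] c a b; rewrite linearP //=.
by rewrite scalerDl scalerA.
Qed.

Lemma tpair_lcontract V W (t : tens V W) (x : dual V) (y : dual W) :
  tpair t x y = y (lcontract x t).
Proof.
rewrite /lcontract /tpair /tlift linear_sum; apply: eq_bigr => i _.
rewrite linear_sum; apply: eq_bigr => j _.
by rewrite /= !dualZ.
Qed.

Lemma lcontract_inj V W (s t : tens V W) :
  (forall x : dual V, lcontract x s = lcontract x t) -> s = t.
Proof.
move=> eq_st; apply/matrixP => i j.
have lcE (q : tens V W) :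
    lcontract (linfun (coord (vbasis {:V}) i : V -> K^o)) q
    = \sum_k q i k *: (vbasis {:W})`_k.
  rewrite /lcontract /tlift (bigD1 i) //= [X in _ + X]big1 ?addr0 => [|k ki].
    apply: eq_bigr => k _.
    by rewrite lfunE /= coord_free ?(basis_free (vbasisP _)) // eqxx scale1r.
  apply: big1 => l _; rewrite lfunE /= coord_free ?(basis_free (vbasisP _)) //.
  by rewrite (negPf ki) scale0r scaler0.
have := eq_st (linfun (coord (vbasis {:V}) i : V -> K^o)).
move/(congr1 (coord (vbasis {:W}) j)).
by rewrite !lcE !coord_sum_free ?(basis_free (vbasisP _)).
Qed.

Lemma tpair_inj V W (s t : tens V W) :
  (forall x y, tpair s x y = tpair t x y) -> s = t.
Proof.
move=> eq_st; apply: lcontract_inj => x; apply: dual_separates => y.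
by rewrite -!tpair_lcontract.
Qed.

Definition tform V W (x : dual V) (y : dual W) (t : tens V W) : K^o :=
  tpair t x y.
HB.instance Definition _ V W (x : dual V) (y : dual W) :=
  GRing.isLinear.Build K (tens V W) K^o _ (tform x y) (tpair_is_linear x y).

Lemma tpairD V W (x : dual V) (y : dual W) s t :
  tpair (s + t) x y = tpair s x y + tpair t x y.
Proof. exact: (linearD (tform x y)). Qed.

Lemma tpairN V W (x : dual V) (y : dual W) t :
  tpair (- t) x y = - tpair t x y.
Proof. exact: (linearN (tform x y)). Qed.

Lemma tpair0 V W (x : dual V) (y : dual W) : tpair 0 x y = 0.
Proof. exact: (linear0 (tform x y)). Qed.

Lemma tpairZ V W (x : dual V) (y : dual W) c t :
  tpair (c *: t) x y = c * tpair t x y.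
Proof. exact: (linearZ_LR (tform x y)). Qed.

Lemma tpair_tlift U V V' W' (f : U -> V -> tens V' W') (t : tens U V) x y :
  tpair (tlift f t) x y = tlift (fun a b => tpair (f a b) x y : K^o) t.
Proof.
rewrite -[LHS]/(tform x y _) /tlift linear_sum; apply: eq_bigr => i _.
by rewrite linear_sum; apply: eq_bigr => j _; rewrite linearZ.
Qed.

Lemma eq_tlift U V W (f g : U -> V -> W) (t : tens U V) :
  (forall a b, f a b = g a b) -> tlift f t = tlift g t.
Proof.
by move=> fg; apply: eq_bigr => i _; apply: eq_bigr => j _; rewrite fg.
Qed.

(** Here [x'] and [y'] are the transposes of [f] and [g] applied to [x] and [y]. *)
Lemma tpair_tmap U V (f : U -> U) (g : V -> V) (t : tens U V)
    (x x' : dual U) (y y' : dual V) :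
  (forall a, x (f a) = x' a) -> (forall b, y (g b) = y' b) ->
  tpair (tmap f g t) x y = tpair t x' y'.
Proof.
move=> xf yg; rewrite tpair_tlift; apply: (@eq_tlift _ _ K^o) => a b.
by rewrite tpair_tensor xf yg.
Qed.

HB.instance Definition _ V W := GRing.Linear.copy (@flip K V W)
  (tlift (fun (v : V) (w : W) => w ⊗ v)).

Lemma tpair_flip V W (t : tens V W) (x : dual W) (y : dual V) :
  tpair (flip t) x y = tpair t y x.
Proof.
rewrite tpair_tlift; apply: (@eq_tlift _ _ K^o) => a b.
by rewrite tpair_tensor mulrC.
Qed.

(** Grouping the basis expansion by rows supplies the pure tensors over which [C_r_sumE] and
    [A_r_sumE] sum. *)
Lemma tens_decomposition V W (t : tens V W) :
  exists s : seq (V * W), t = \sum_(p <- s) p.1 ⊗ p.2.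
Proof.
pose f (i : 'I_(\dim {:V})) := ((vbasis {:V})`_i,
  \sum_j t i j *: (vbasis {:W})`_j).
exists [seq f i | i <- index_enum _].
rewrite big_map {1}(tens_sumE t); apply: eq_bigr => i _ /=.
by rewrite linear_sumr; apply: eq_bigr => j _; rewrite linearZr_LR.
Qed.

Definition tpair3 U V W (x : dual U) (y : dual V) (z : dual W)
    (t : tens U (tens V W)) : K^o := tpair (lcontract x t) y z.
HB.instance Definition _ U V W (x : dual U) (y : dual V) (z : dual W) :=
  GRing.Linear.copy (@tpair3 U V W x y z)
    (tform y z \o @lcontract U (tens V W) x).

Lemma tpair3_tensor U V W (x : dual U) (y : dual V) (z : dual W) u v w :
  tpair3 x y z (u ⊗ v ⊗ w) = x u * y v * z w.
Proof.
by rewrite /tpair3 lcontract_tensor tpairZ tpair_tensor mulrA.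
Qed.

Lemma tpair3_inj U V W (s t : tens U (tens V W)) :
  (forall x y z, tpair3 x y z s = tpair3 x y z t) -> s = t.
Proof.
move=> eq_st; apply: lcontract_inj => x; apply: tpair_inj => y z.
exact: eq_st.
Qed.

Lemma bilinear_double_sum (I : Type) (s : seq I) U V W
    (op : {bilinear U -> V -> W}) (f g : I -> K) (a : I -> U) (b : I -> V) :
  op (\sum_(p <- s) f p *: a p) (\sum_(q <- s) g q *: b q) =
  \sum_(p <- s) \sum_(q <- s) (f p * g q) *: op (a p) (b q).
Proof.
rewrite linear_sumlz; apply: eq_bigr => p _.
rewrite linearZl_LR linear_sumr scaler_sumr; apply: eq_bigr => q _.
by rewrite linearZr_LR scalerA.
Qed.

(** * Products of two copies of a tensor, expressed by contractions *)

Section YangBaxterTerms.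
Variables (A : vectType K) (op : {bilinear A -> A -> A}) (r : tens A A).
Variable s : seq (A * A).
Hypothesis rE : r = \sum_(p <- s) p.1 ⊗ p.2.

Let lcE (x : dual A) : lcontract x r = \sum_(p <- s) x p.1 *: p.2.
Proof.
by rewrite rE linear_sum; apply: eq_bigr => p _; rewrite /= lcontract_tensor.
Qed.

Let rcE (x : dual A) : lcontract x (flip r) = \sum_(p <- s) x p.2 *: p.1.
Proof.
rewrite rE [flip _]linear_sum linear_sum; apply: eq_bigr => p _.
by rewrite /= flip_tensor lcontract_tensor.
Qed.

(* The suffixes are the legs of the usual notation r12 r13, r13 r23, r12 r23. *)
Lemma tpair3_12_13 (x y z : dual A) :
  tpair3 x y z (\sum_(p <- s) \sum_(q <- s) op p.1 q.1 ⊗ p.2 ⊗ q.2) =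
  x (op (lcontract y (flip r)) (lcontract z (flip r))).
Proof.
rewrite !rcE bilinear_double_sum !linear_sum; apply: eq_bigr => p _.
rewrite !linear_sum; apply: eq_bigr => q _.
by rewrite /= tpair3_tensor dualZ -mulrA mulrC.
Qed.

Lemma tpair3_13_23 (x y z : dual A) :
  tpair3 x y z (\sum_(p <- s) \sum_(q <- s) p.1 ⊗ q.1 ⊗ op p.2 q.2) =
  z (op (lcontract x r) (lcontract y r)).
Proof.
rewrite !lcE bilinear_double_sum !linear_sum; apply: eq_bigr => p _.
rewrite !linear_sum; apply: eq_bigr => q _.
by rewrite /= tpair3_tensor dualZ.
Qed.

Lemma tpair3_12_23 (x y z : dual A) :
  tpair3 x y z (\sum_(p <- s) \sum_(q <- s) p.1 ⊗ op p.2 q.1 ⊗ q.2) =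
  y (op (lcontract x r) (lcontract z (flip r))).
Proof.
(* The first copy of [r] loses its first leg to [x], the second copy its second leg to [z], hence
   one plain and one flipped contraction. *)
rewrite lcE rcE bilinear_double_sum !linear_sum; apply: eq_bigr => p _.
rewrite !linear_sum; apply: eq_bigr => q _.
by rewrite /= tpair3_tensor dualZ mulrAC.
Qed.

End YangBaxterTerms.

End Contraction.

(** * Consequences of invariance and of the antisymmetry of [P] *)

Section RotaBaxter.
Variables (K : fieldType) (A : vectType K) (B : {symmetric A}) (P : 'End(A)).
Hypothesis B_nondegenerate : nondegenerate B.
Hypothesis B_compat : forall a b, B a (P b) + B (P a) b + 0 * B a b = 0.

Lemma formC a b : B a b = B b a.
Proof. by rewrite hermC expr0 mul1r. Qed.

Lemma formDl a b c : B (a + b) c = B a c + B b c.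
Proof. exact: linearDl. Qed.

Lemma formDr a b c : B a (b + c) = B a b + B a c.
Proof. exact: linearDr. Qed.

Lemma form0r a : B a 0 = 0.
Proof. exact: linear0r. Qed.

Lemma formNr a b : B a (- b) = - B a b.
Proof. exact: linearNr. Qed.

Lemma formP a b : B (P a) b = - B a (P b).
Proof.
by apply/eqP; rewrite -addr_eq0 addrC; have /eqP := B_compat a b;
  rewrite mul0r addr0.
Qed.

(** The descendent product of a Rota-Baxter operator of weight 0. *)
Definition star (op : A -> A -> A) a b := op (P a) b + op a (P b).

Lemma rota_baxter_star (op : A -> A -> A) : rota_baxter 0 op P ->
  forall a b, P (star op a b) = op (P a) (P b).
Proof. by move=> RB a b; rewrite RB scale0r addr0. Qed.

Section InvariantOperations.
Variables (op op' : {bilinear A -> A -> A}).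
Hypothesis op_invariant : Defs.invariant op B.
Hypothesis op'_invariant : Defs.invariant op' B.

Lemma invariant_rot a b c : B a (op b c) = B b (op c a).
Proof. by rewrite formC op_invariant. Qed.

(** Write [op (P a) (P b)] as [P (star op a b)] and move the outer [P] onto [c]: the two resulting
    terms are, by invariance, the negatives of the other two summands. *)
Lemma rota_baxter_cyclic : rota_baxter 0 op P -> forall a b c,
  B (op (P a) (P b)) c + B (op (P b) (P c)) a + B (op (P c) (P a)) b = 0.
Proof.
move=> RB a b c; rewrite -rota_baxter_star // formP /star formDl.
have -> : B (op (P a) b) (P c) = B (op (P c) (P a)) b.
  by rewrite op_invariant invariant_rot formC.
by rewrite (op_invariant a) (formC a); ring.
Qed.

(** Rotate the outer [P] to the front, move it across [B] at the cost of a sign, and rotate back.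
    Two operations are allowed because the mixed conditions pair a [br] term with a [mu] term. *)
Lemma form_rota_baxter a b u v :
  B b (op (P (op' u a)) v) = - B a (op' (P (op v b)) u).
Proof.
by rewrite invariant_rot formP op'_invariant -[in RHS]op'_invariant (formC u).
Qed.

End InvariantOperations.

(** * The descendent products form a Poisson algebra *)

Section DualPoisson.
Variables (br mu : {bilinear A -> A -> A}).
Hypothesis poisson : poisson_algebra br mu.
Hypotheses (br_RB : rota_baxter 0 br P) (mu_RB : rota_baxter 0 mu P).

Lemma br_antisym a b : br a b = - br b a.
Proof.
apply/eqP; rewrite -addr_eq0; apply/eqP.
have := br_alternating poisson (a + b).
by rewrite !(linearDl, linearDr) !(br_alternating poisson) add0r addr0.
Qed.

Lemma br_star_alternating a : star br a a = 0.
Proof. by rewrite /star br_antisym addNr. Qed.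

Lemma br_star_jacobi a b c :
  star br a (star br b c) + star br b (star br c a)
    + star br c (star br a b) = 0.
Proof.
rewrite {1 3 5}/star !rota_baxter_star // /star !linearDr.
(* Each of the nine terms has [P] on two of the three arguments; grouped by the argument free of
   [P], they are three Jacobi sums. *)
rewrite (AC (3*3*3) ((1*5*9)*(2*6*7)*(3*4*8))) /=.
by rewrite !(br_jacobi poisson) !addr0.
Qed.

Lemma mu_star_comm : commutative (star mu).
Proof.
move=> a b; rewrite /star addrC.
by rewrite (mu_comm poisson (P a)) (mu_comm poisson a).
Qed.

Lemma mu_star_assoc : associative (star mu).
Proof.
move=> a b c; rewrite {1 3}/star !rota_baxter_star // /star linearDl linearDr.
by rewrite !(mu_assoc poisson) addrA.
Qed.

Lemma star_leibniz a b c :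
  star br a (star mu b c) = star mu (star br a b) c + star mu b (star br a c).
Proof.
rewrite {1 3 5}/star !rota_baxter_star // /star !(linearDl, linearDr).
rewrite !(poisson_leibniz poisson).
(* Terms 1, 3, 5 are those bracketing into [b], terms 2, 6, 4 those bracketing into [c]. *)
by rewrite (AC (2*2*2) ((1*(3*5))*((2*6)*4))).
Qed.

End DualPoisson.

(** * The tensor [r] as the operator [P] *)

Section Triangular.
Variable r : tens A A.
Hypothesis rE :
  forall x y : dual A, tpair r x y = y ((P \o form_iso B)%VF x).
Let flat := form_flat B.

Let flatE a b : flat a b = B a b. Proof. exact: form_flatE. Qed.

(** By nondegeneracy every functional is some [B a], so identities on the dual need checking only on
    the image of [flat]. *)
Let flat_surj (Q : dual A -> Prop) : (forall a, Q (flat a)) -> forall x, Q x.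
Proof.
have [_ isoK] := form_iso_bij B_nondegenerate.
by move=> Qflat x; rewrite -(isoK x).
Qed.

Lemma tpair_flat_inj (s t : tens A A) :
  (forall u v, tpair s (flat u) (flat v) = tpair t (flat u) (flat v)) -> s = t.
Proof.
by move=> eq_st; apply: tpair_inj; apply: flat_surj => u; apply: flat_surj.
Qed.

Lemma tpair_r u v : tpair r (flat u) (flat v) = B (P u) v.
Proof.
have [flatK _] := form_iso_bij B_nondegenerate.
by rewrite rE comp_lfunE flatK flatE formC.
Qed.

Lemma r_antisymmetric : r + flip r = 0.
Proof.
apply: tpair_flat_inj => u v; rewrite tpairD tpair_flip tpair0 !tpair_r.
by rewrite formP formC addNr.
Qed.

Lemma lcontract_r u : lcontract (flat u) r = P u.
Proof.
apply: dual_separates; apply: flat_surj => v.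
by rewrite -tpair_lcontract tpair_r flatE formC.
Qed.

Lemma lcontract_flip_r u : lcontract (flat u) (flip r) = - P u.
Proof.
have /eqP := r_antisymmetric; rewrite addrC addr_eq0 => /eqP ->.
by rewrite linearN /= lcontract_r.
Qed.

Section Op.
Variable op : {bilinear A -> A -> A}.
Hypothesis op_inv : Defs.invariant op B.

(** Invariance makes right multiplication by [a] the transpose of [op a], whatever the symmetry of
    [op]; this serves both [br] and [mu]. *)
Lemma tpair_tmapl (t : tens A A) a u v :
  tpair (tmap (op a) id t) (flat u) (flat v) =
  tpair t (flat (op u a)) (flat v).
Proof. by apply: tpair_tmap => // b; rewrite !flatE op_inv. Qed.

Lemma tpair_tmapr (t : tens A A) a u v :
  tpair (tmap id (op a) t) (flat u) (flat v) =
  tpair t (flat u) (flat (op v a)).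
Proof. by apply: tpair_tmap => // b; rewrite !flatE op_inv. Qed.
End Op.

(** * Yang-Baxter equations, dual Poisson algebra and compatibility conditions *)

Section Bialgebra.
Variables (br mu : {bilinear A -> A -> A}).
Hypothesis poisson : poisson_algebra br mu.
Hypotheses (br_inv : Defs.invariant br B) (mu_inv : Defs.invariant mu B).
Hypotheses (br_RB : rota_baxter 0 br P) (mu_RB : rota_baxter 0 mu P).

Let brN := br_antisym poisson.
Let muC := mu_comm poisson.

Lemma C_r_eq0 : C_r br r = 0.
Proof.
have [s sE] := tens_decomposition r.
apply: tpair3_inj; apply: flat_surj => u; apply: flat_surj => v.
apply: flat_surj => w.
rewrite (C_r_sumE br sE) [RHS]linear0.
under eq_bigr do rewrite !big_split.
rewrite !big_split !linearD /=.
rewrite (tpair3_12_13 br sE) (tpair3_13_23 br sE) (tpair3_12_23 br sE).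
rewrite !lcontract_r !lcontract_flip_r !flatE.
(* Two flipped contractions cancel their signs; a single one reverses the bracket, which puts the
   three terms in cyclic order. *)
have brNN x y : br (- x) (- y) = br x y by rewrite linearNl linearNr opprK.
have brNr x y : br x (- y) = br y x by rewrite brN linearNl opprK.
rewrite brNN brNr -[RHS](rota_baxter_cyclic br_inv br_RB u v w).
rewrite -(formC u) -(formC v) -(formC w) (addrC (B w _)).
by congr (_ + _); exact: addrC.
Qed.

Lemma A_r_eq0 : A_r mu r = 0.
Proof.
have [s sE] := tens_decomposition r.
apply: tpair3_inj; apply: flat_surj => u; apply: flat_surj => v.
apply: flat_surj => w.
rewrite (A_r_sumE mu sE) [RHS]linear0.
under eq_bigr do rewrite sumrB big_split; rewrite sumrB big_split.
(* Commutativity brings the last term to the order of factors in [tpair3_12_23]. *)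
under [X in _ - X]eq_bigr do under eq_bigr do rewrite muC.
rewrite linearB linearD /=.
rewrite (tpair3_12_13 mu sE) (tpair3_13_23 mu sE) (tpair3_12_23 mu sE).
rewrite !lcontract_r !lcontract_flip_r !flatE.
have muNN x y : mu (- x) (- y) = mu x y by rewrite linearNl linearNr opprK.
have muNr x y : mu x (- y) = - mu y x by rewrite muC linearNl.
rewrite muNN muNr formNr -[RHS](rota_baxter_cyclic mu_inv mu_RB u v w).
by rewrite -(formC u) -(formC v) -(formC w) (addrC (B w _)) [X in _ + X]opprK.
Qed.

Lemma tpair_delta_r a u v :
  tpair (delta_r br r a) (flat u) (flat v) = B a (star br u v).
Proof.
rewrite tpairD (tpair_tmapl br_inv) (tpair_tmapr br_inv) !tpair_r /star formDr.
rewrite (invariant_rot br_inv) (invariant_rot br_inv v); congr (_ + _).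
by rewrite formP br_inv (invariant_rot br_inv) (brN u) formNr.
Qed.

(** The minus sign in [Delta_r] offsets the one from moving [P] across [B]; for [delta_r]
    antisymmetry of [br] does this. *)
Lemma tpair_Delta_r a u v :
  tpair (Delta_r mu r a) (flat u) (flat v) = B a (star mu u v).
Proof.
rewrite tpairD tpairN (tpair_tmapl mu_inv) (tpair_tmapr mu_inv) !tpair_r.
rewrite /star formDr (invariant_rot mu_inv) (invariant_rot mu_inv v).
by rewrite formP mu_inv (invariant_rot mu_inv u) (muC (P v)) opprK.
Qed.

Lemma dual_op_delta_r u v :
  dual_op (delta_r br r) (flat u) (flat v) = flat (star br u v).
Proof.
by apply/lfunP => a; rewrite dual_opE tpair_delta_r flatE formC.
Qed.

Lemma dual_op_Delta_r u v :
  dual_op (Delta_r mu r) (flat u) (flat v) = flat (star mu u v).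
Proof.
by apply/lfunP => a; rewrite dual_opE tpair_Delta_r flatE formC.
Qed.

(** The surjection [flat] carries [star br] and [star mu] to the dual operations, so the axioms
    transfer. *)
Lemma dual_poisson :
  poisson_algebra (dual_op (delta_r br r)) (dual_op (Delta_r mu r)).
Proof.
split=> /=; apply: flat_surj => a.
- by rewrite dual_op_delta_r (br_star_alternating poisson) linear0.
- apply: flat_surj => b; apply: flat_surj => c; rewrite !dual_op_delta_r.
  by rewrite -!linearD (br_star_jacobi poisson br_RB) linear0.
- apply: flat_surj => b; rewrite !dual_op_Delta_r.
  by rewrite (mu_star_comm poisson).
- apply: flat_surj => b; apply: flat_surj => c; rewrite !dual_op_Delta_r.
  by rewrite (mu_star_assoc poisson mu_RB).
apply: flat_surj => b; apply: flat_surj => c.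
rewrite !(dual_op_delta_r, dual_op_Delta_r) -linearD.
by rewrite (star_leibniz poisson br_RB mu_RB).
Qed.

Lemma delta_r_br a b :
  delta_r br r (br a b) =
    (tmap (br a) id (delta_r br r b) + tmap id (br a) (delta_r br r b))
  - (tmap (br b) id (delta_r br r a) + tmap id (br b) (delta_r br r a)).
Proof.
apply: tpair_flat_inj => u v; rewrite [LHS]tpair_delta_r.
rewrite !(tpairD, tpairN) !(tpair_tmapl br_inv) !(tpair_tmapr br_inv).
(* The terms with [P] of a bracket cancel between the [delta_r b] and [delta_r a] parts. *)
have rb x y : B y (br (P (br u x)) v) = B x (br u (P (br v y))).
  by rewrite (form_rota_baxter br_inv br_inv) brN formNr opprK.
have jac x q : B b (br (br x a) q) - B a (br (br x b) q) = B (br a b) (br x q).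
  have := congr1 (B x) (br_jacobi poisson q a b).
  rewrite !formDr (brN b q) linearNr formNr form0r => jac0.
  rewrite [RHS]formC (invariant_rot br_inv b) (invariant_rot br_inv a) !br_inv.
  by apply/eqP; rewrite eq_sym -subr_eq0 -jac0; apply/eqP; ring.
have jac' : B b (br (P u) (br v a)) - B a (br (P u) (br v b))
            = B (br a b) (br (P u) v).
  rewrite !(brN (P u)) !formNr -(jac v (P u)); ring.
rewrite !tpair_delta_r /star !formDr (rb a b) (rb b a).
by rewrite -jac' -jac; ring.
Qed.

Lemma Delta_r_mu a b :
  Delta_r mu r (mu a b) =
    tmap (mu a) id (Delta_r mu r b) + tmap id (mu b) (Delta_r mu r a).
Proof.
apply: tpair_flat_inj => u v; rewrite [LHS]tpair_Delta_r.
rewrite !(tpairD, tpairN) (tpair_tmapl mu_inv) (tpair_tmapr mu_inv).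
rewrite !tpair_Delta_r /star !formDr (form_rota_baxter mu_inv mu_inv).
have -> : B b (mu (mu u a) (P v)) = B (mu a b) (mu u (P v)).
  by rewrite (muC a) mu_inv (mu_assoc poisson) (muC a).
have -> : B a (mu (P u) (mu v b)) = B (mu a b) (mu (P u) v).
  by rewrite mu_inv (muC b) -(mu_assoc poisson).
by rewrite (muC u (P (mu v b))); ring.
Qed.

Lemma delta_r_mu a b :
  delta_r br r (mu a b) =
    tmap (mu a) id (delta_r br r b) + tmap (mu b) id (delta_r br r a)
  + tmap id (br a) (Delta_r mu r b) + tmap id (br b) (Delta_r mu r a).
Proof.
apply: tpair_flat_inj => u v; rewrite [LHS]tpair_delta_r.
rewrite !(tpairD, tpairN) !(tpair_tmapl mu_inv) !(tpair_tmapr br_inv).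
rewrite !(tpair_delta_r, tpair_Delta_r) /star !formDr.
have leib x q :
    B b (br (mu x a) q) + B a (br (mu x b) q) = B (mu a b) (br x q).
  rewrite [RHS]formC (invariant_rot br_inv b) (invariant_rot br_inv a).
  rewrite !mu_inv br_inv.
  by rewrite (poisson_leibniz poisson) formDr addrC (muC b).
have leib' x y :
    B b (mu x (br y a)) + B a (mu x (br y b)) = B (mu a b) (br x y).
  rewrite [RHS]formC (invariant_rot mu_inv b) (invariant_rot mu_inv a) br_inv.
  by rewrite (poisson_leibniz poisson) formDr (muC a).
(* Here a term of [delta_r] at one element cancels a term of [Delta_r] at the other. *)
have rb x y : B y (br (P (mu u x)) v) = - B x (mu u (P (br v y))).
  by rewrite (form_rota_baxter br_inv mu_inv) muC.
by rewrite (rb a b) (rb b a) -(leib u) -(leib' (P u)); ring.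
Qed.

Lemma Delta_r_br a b :
  Delta_r mu r (br a b) =
    (tmap (br a) id (Delta_r mu r b) + tmap id (br a) (Delta_r mu r b))
  + (tmap (mu b) id (delta_r br r a) - tmap id (mu b) (delta_r br r a)).
Proof.
apply: tpair_flat_inj => u v; rewrite [LHS]tpair_Delta_r.
rewrite !(tpairD, tpairN) (tpair_tmapl mu_inv) (tpair_tmapl br_inv).
rewrite (tpair_tmapr mu_inv) (tpair_tmapr br_inv).
rewrite !(tpair_delta_r, tpair_Delta_r) /star !formDr.
have leib x q :
    B b (mu (br x a) q) + B a (br (mu x b) q) = B (br a b) (mu x q).
  rewrite [RHS]formC (invariant_rot mu_inv b) (invariant_rot br_inv a).
  rewrite br_inv !mu_inv.
  rewrite (poisson_leibniz poisson) formDr (brN a q) linearNl formNr.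
  rewrite (muC b); ring.
have leib' : B (br a b) (mu (P u) v)
    = B b (mu (P u) (br v a)) - B a (br (P u) (mu v b)).
  rewrite (muC (P u) v) -(leib v) (muC (br v a)).
  by rewrite (brN (mu v b)) formNr.
(* Both terms of [Delta_r b] with [P] of a bracket cancel those of [delta_r a] with [P] of a product
   under [mu]. *)
rewrite (form_rota_baxter mu_inv br_inv a b).
rewrite (form_rota_baxter br_inv mu_inv b a u v).
rewrite (brN (P (mu v b))) formNr.
by rewrite leib' -(leib u) (muC u (P (br v a))); ring.
Qed.

End Bialgebra.
End Triangular.
End RotaBaxter.

Theorem proposition4p6 (K : fieldType) (charK0 : [pchar K] =i pred0)
    (A : vectType K) (br mu : {bilinear A -> A -> A}) (B : {symmetric A})
    (P : 'End(A)) (r : tens A A) :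
  quadratic_rota_baxter_poisson br mu B P 0 ->
  (forall x y : dual A, tpair r x y = y ((P \o form_iso B)%VF x)) ->
  triangular_poisson_bialgebra br mu r.
Proof.
move=> [poisson B_nd br_inv mu_inv br_RB mu_RB B_compat] rE.
split; first exact: (r_antisymmetric B_nd B_compat rE).
  split; first exact: (C_r_eq0 B_nd B_compat rE poisson br_inv br_RB).
  exact: (A_r_eq0 B_nd B_compat rE poisson mu_inv mu_RB).
split=> //.
- exact: (dual_poisson B_nd B_compat rE poisson br_inv mu_inv).
- exact: (delta_r_br B_nd B_compat rE poisson br_inv).
- exact: (Delta_r_mu B_nd B_compat rE poisson mu_inv).
- exact: (delta_r_mu B_nd B_compat rE poisson br_inv mu_inv).
exact: (Delta_r_br B_nd B_compat rE poisson br_inv mu_inv).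
Qed.
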